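(* Let $X$ be a polynomial vector field of degree $d$ on $\mathbb{C}^2$, let $f$ be an invariant algebraic curve of $X$, and let $l$ be a positive integer. Then $$\mu_{g,l}(X,f)\le\mu_{a,l}(X,f),$$ where $\mu_{g,l}$ is the $l$-geometric multiplicity and $\mu_{a,l}$ is the $l$-algebraic multiplicity.
   Context: A polynomial vector field of degree $d$ on $\mathbb{C}^2$ is $X=a\,\frac{\partial}{\partial x}+b\,\frac{\partial}{\partial y}$ with $a,b\in\mathbb{C}[x,y]$ and $\max(\deg a,\deg b)=d$; it acts by $X(f)=a f_x+b f_y$. An algebraic curve $\{f=0\}$ (or simply $f$), $f\in\mathbb{C}[x,y]$, is invariant by $X$ if $X(f)/f$ is a polynomial. Geometric multiplicity: an invariant algebraic curve $f$ of $X$ has $l$-geometric multiplicity $\mu_{g,l}(X,f)=m$ if $m$ is the largest number (possibly $+\infty$) for which there exists a sequence of vector fields $X_k$ of degree $d$ converging to $X$ such that each $X_k$ has $m$ distinct invariant algebraic curves $f_k^{(1)},\ldots,f_k^{(m)}$ of degree at most $l$, all converging to $f$ as $k\to\infty$. Distinct means that pairwise they have no common factors; convergence of vector fields and of curves means convergence of the coefficients of the polynomials involved. If $l<\deg f$ then $\mu_{g,l}(X,f)=0$. Algebraic multiplicity: the $l$-th extactic curve $\mathcal{E}_l(X)$ is the polynomial $\det\big(X^{i}(v_j)\big)_{0\le i\le N-1,\ 1\le j\le N}$, where $N=(l+1)(l+2)/2$, $v_1,\ldots,v_N$ is a basis of the $\mathbb{C}$-vector space of polynomials in $\mathbb{C}[x,y]$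 of degree at most $l$, $X^0(v)=v$ and $X^{i}(v)=X(X^{i-1}(v))$. The number $\mu_{a,l}(X,f)$ is the greatest positive integer $m$ such that $f^m$ divides $\mathcal{E}_l(X)$ ($+\infty$ if $\mathcal{E}_l(X)=0$), and it is $0$ if $l<\deg f$. *)

(* Defs.v *)
(* The complex numbers are R[i] for R : realType.  The
   multivariate polynomials are imported without their notations, which cannot
   be parsed together with those of MathComp-Analysis. *)
From HB Require Import structures.
From mathcomp Require Import all_boot all_order all_algebra.
From mathcomp Require Import complex.
From mathcomp Require Import boolp classical_sets reals ereal topology.
From mathcomp Require Import normedtype sequences.
From mathcomp Require Import -(notations) mpoly.

Set Implicit Arguments.
Unset Strict Implicit.
Unset Printing Implicit Defensive.

Import Order.TTheory GRing.Theory Num.Theory.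
Import numFieldNormedType.Exports.

Local Open Scope classical_set_scope.
Local Open Scope ring_scope.

Notation polyxy R := (mpoly 2 R[i]).

(* The pair (a, b) stands for a d/dx + b d/dy; x and y are the variables of
   index 0 and 1. *)
Notation vfield R := (polyxy R * polyxy R)%type.

Section Definitions.
Variable R : realType.
Implicit Types (f g p : polyxy R) (X : vfield R) (d l m N : nat).

(* msize p is one plus the total degree of p, and 0 when p = 0; hence
   this bound holds for p = 0, whatever l. *)
Definition deg_le l p : Prop := (msize p <= l.+1)%N.

(* The zero vector field has no degree. *)
Definition vfield_degree d X : Prop :=
  maxn (msize X.1) (msize X.2) = d.+1.

Definition vapply X f : polyxy R :=
  X.1 * mderiv (ord0 : 'I_2) f + X.2 * mderiv (ord_max : 'I_2) f.

Definition pdvd f g : Prop := exists h, g = f * h.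

(* A curve is given by a nonconstant polynomial. *)
Definition invariant_curve X f : Prop :=
  (1 < msize f)%N /\ pdvd f (vapply X f).

Definition no_common_factor f g : Prop :=
  forall h, (1 < msize h)%N -> ~ (pdvd h f /\ pdvd h g).

(* R[i]^o is R[i] with the topology of the complex modulus. *)
Definition cvg_poly (u : nat -> polyxy R) p : Prop :=
  forall e : multinom 2,
    (fun k => mcoeff e (u k) : R[i]^o) @ \oo
      --> (mcoeff e p : R[i]^o).

Definition cvg_vfield (u : nat -> vfield R) X : Prop :=
  cvg_poly (fun k => (u k).1) X.1 /\ cvg_poly (fun k => (u k).2) X.2.

Definition geom_realizable d l X f m : Prop :=
  exists (Xs : nat -> vfield R) (fs : nat -> 'I_m -> polyxy R),
    [/\ forall k, vfield_degree d (Xs k),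
        cvg_vfield Xs X,
        forall k i, invariant_curve (Xs k) (fs k i) /\ deg_le l (fs k i),
        forall k i j, i != j -> no_common_factor (fs k i) (fs k j) &
        forall i, cvg_poly (fun k => fs k i) f].

(* The supremum in \bar R of a nonempty set of natural numbers is its largest
   element, or +oo when the set is unbounded. *)
Definition geom_mult d l X f : \bar R :=
  if (l.+1 < msize f)%N then 0%E
  else ereal_sup [set (m%:R : R)%:E | m in geom_realizable d l X f].

Definition dim_deg_le l : nat := ((l.+1 * l.+2) %/ 2)%N.

Definition is_basis_deg_le l N (v : 'I_N -> polyxy R) : Prop :=
  [/\ forall j, deg_le l (v j),
      forall c : 'I_N -> R[i],
        \sum_(j < N) c j *: v j = 0 -> forall j, c j = 0 &
      forall p, deg_le l p ->
        exists c : 'I_N -> R[i], p = \sum_(j < N) c j *: v j].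

Definition extactic N (v : 'I_N -> polyxy R) X : polyxy R :=
  \det (\matrix_(i < N, j < N) iter i (vapply X) (v j)).

(* For f invariant with deg f <= l, f divides the extactic polynomial, so that
   the set below is nonempty.  The value does not depend on the basis v, since a
   change of basis multiplies the determinant by a nonzero constant. *)
Definition alg_mult l (v : 'I_(dim_deg_le l) -> polyxy R) X f : \bar R :=
  if (l.+1 < msize f)%N then 0%E
  else if extactic v X == 0 then +oo%E
  else ereal_sup [set (m%:R : R)%:E | m in
         [set m : nat | (0 < m)%N /\ pdvd (f ^+ m) (extactic v X)]].

End Definitions.

(* Main.v *)
Require Import Defs.
From HB Require Import structures.
From mathcomp Require Import all_boot all_order all_algebra.
From mathcomp Require Import complex.
From mathcomp Require Import boolp classical_sets reals ereal topology.
From mathcomp Require Import normedtype sequences.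
From mathcomp Require Import -(notations) mpoly.
From mathcomp Require Import ring.

(** The inequality holds because a product of pairwise coprime invariant curves
    divides the extactic polynomial, and because divisibility survives passage
    to the limit.

    Let f be an invariant curve of degree at most l, and let M be the matrix
    whose determinant is the extactic polynomial.  Writing f as a combination
    c of the basis v and using that each X^i is C-linear gives M c = (X^i f)_i,
    all of whose entries are multiples of f.  Multiplying by the adjugate,
    det M times each c_j is a multiple of f; some c_j is a nonzero constant,
    so f divides the extactic polynomial (invariant_dvd_extactic).

    If X_k converges to X and has m pairwise coprime invariant curves of degree
    at most l, then each of them divides the extactic polynomial of X_k, hence
    so does their product (prod_coprime_dvd).  This uses that C[x,y] is a
    unique factorization domain, in the form of Euclid's lemma: if f divides
    g b and has no common factor with g, then f divides b.  It is proved in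
    C[x][y] (euclid_bivariate), where a Bezout relation over C(x) gives a
    nonzero r in C[x] such that f divides r b; as C is algebraically closed, r
    is a product of factors x - a, which are prime and can be cancelled one by
    one.

    As k goes to infinity the product converges to f^m and the extactic
    polynomial of X_k to that of X, all with bounded degree.  It remains to
    see that the relation p_k | q_k passes to the limit if the limit p of the
    p_k is nonzero (pdvd_limit).  Let A_k be the matrix of multiplication by
    p_k between spaces of polynomials of bounded degree, and A its limit, which
    is injective and so has a one-sided inverse B.  From q_k = h_k A_k follows
      det(A_k B) q_k = q_k B adj(A_k B) A_k,
    in which the unknown quotient h_k no longer appears.  In the limit A B = 1,
    so q = (q B) A is a multiple of p. *)

Set Implicit Arguments.
Unset Strict Implicit.
Unset Printing Implicit Defensive.

Import Order.TTheory GRing.Theory Num.Theory.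
Import numFieldNormedType.Exports.

Local Open Scope classical_set_scope.

Local Open Scope ring_scope.


(** * Euclid's lemma in C[x][y] *)

Definition divides (A : comNzRingType) (f g : A) : Prop := exists h, g = f * h.

Section BivariateEuclid.
Variable F : closedFieldType.
Local Notation A := {poly F}.
Local Notation B := {poly {poly F}}.
Implicit Types (f g h a b p q s : B) (r : A) (x : F).

Definition linX x : B := ('X - x%:P)%:P.

Lemma linX_neq0 x : linX x != 0.
Proof. by rewrite polyC_eq0 polyXsubC_eq0. Qed.

Lemma linX_dvdP x p : divides (linX x) p <-> map_poly (horner_eval x) p = 0.
Proof.
split=> [[q ->]|p0].
  rewrite rmorphM /= /linX map_polyC /= /horner_eval hornerXsubC subrr.
  by rewrite polyC0 mul0r.
have /factor_theorem[q eq] : root (swapXY p) x%:P.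
  by rewrite /root horner_swapXY p0.
exists (swapXY q); rewrite -[LHS]swapXYK eq rmorphM rmorphB /= swapXY_X swapXY_polyC.
by rewrite map_polyC /= mulrC /linX polyCB.
Qed.

(** Setting the inner variable to x is a morphism to a domain, with kernel
    generated by linX x. *)
Lemma linX_prime x p q :
  divides (linX x) (p * q) -> divides (linX x) p \/ divides (linX x) q.
Proof.
move=> /linX_dvdP; rewrite rmorphM => /eqP; rewrite mulf_eq0.
by case/orP=> /eqP /linX_dvdP; [left|right].
Qed.

(** The linear factors of r are removed one at a time: each is prime and does
    not divide f, so it divides s. *)
Lemma divides_of_scaled f b r s : r != 0 ->
  (forall x, ~ divides (linX x) f) -> r%:P * b = f * s -> divides f b.
Proof.
move=> r0 fL; move: {2}(size r) (leqnn (size r)) => n.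
elim: n r s r0 => [|n IHn] r s r0 ler.
  by rewrite leqn0 size_poly_eq0 (negPf r0) in ler.
have [/eqP/size_poly1P[c c0 ->] eq|/closed_rootP[x]] := eqVneq (size r) 1%N.
  exists (c^-1%:P%:P * s); rewrite mulrCA -eq mulrA -!polyCM mulVf //.
  by rewrite !polyC1 mul1r.
case/factor_theorem=> r' er eq; subst r.
have r'0 : r' != 0 by apply: contraNneq r0 => ->; rewrite mul0r.
have [//|[s' es]] : divides (linX x) f \/ divides (linX x) s.
- by apply: linX_prime; exists (r'%:P * b); rewrite -eq polyCM /linX; ring.
- by move=> /fL.
apply: (IHn r' s' r'0).
  by rewrite size_Mmonic ?monicXsubC // size_XsubC addn2 in ler.
apply: (mulfI (linX_neq0 x)).
by rewrite [RHS]mulrCA -es -eq polyCM /linX; ring.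
Qed.

(** The degree in the inner variable is the measure for the inductions that
    strip factors linX x. *)
Lemma size_swapXY_linX x p : p != 0 ->
  size (swapXY (linX x * p)) = (size (swapXY p)).+1.
Proof.
move=> p0; rewrite rmorphM /= swapXY_polyC rmorphB /= map_polyX map_polyC /=.
by rewrite size_monicM ?monicXsubC ?swapXY_eq0 ?size_XsubC.
Qed.

(** Over an algebraically closed field, having no factor linX x amounts to
    being primitive as a polynomial in the outer variable: r is the content. *)
Lemma linX_free_part p : p != 0 ->
  exists r q, [/\ r != 0, p = r%:P * q & forall x, ~ divides (linX x) q].
Proof.
move: {2}(size (swapXY p)) (leqnn (size (swapXY p))) => n.
elim: n p => [|n IHn] p len p0.
  by rewrite leqn0 size_poly_eq0 swapXY_eq0 (negPf p0) in len.
have [[x [q ep]]|noL] := pselect (exists x, divides (linX x) p); last first.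
  exists 1, p; split; rewrite ?oner_eq0 ?mul1r // => x px.
  by apply: noL; exists x.
have q0 : q != 0 by apply: contraNneq p0 => q0; rewrite ep q0 mulr0.
rewrite ep size_swapXY_linX // in len.
have [r [q' [r0 eq q'L]]] := IHn q len q0.
exists (('X - x%:P) * r), q'; split=> //.
- by rewrite mulf_neq0 // polyXsubC_eq0.
- by rewrite ep eq mulrA polyCM.
Qed.

(** Gauss's lemma: %| is pseudo-divisibility, that is, divisibility over the
    fraction field of {poly F}; for a primitive h it is true divisibility. *)
Lemma divides_of_dvdp h f :
  (forall x, ~ divides (linX x) h) -> h %| f -> divides h f.
Proof.
move=> hL /Pdiv.Idomain.dvdpP[[c s] /= c0 eq].
by apply: (divides_of_scaled c0 hL (s := s)); rewrite mul_polyC eq mulrC.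
Qed.

Definition only_constant_common f g : Prop :=
  forall h, divides h f -> divides h g -> exists c : F, h = c%:P%:P.

Lemma linX_nonconstant x : ~ exists c : F, linX x = c%:P%:P.
Proof.
move=> [c /polyC_inj/(congr1 (fun p : A => size p))].
by rewrite size_XsubC size_polyC; case: eqP.
Qed.

(** The primitive part of the gcd over the fraction field is a genuine common
    factor of f and g, hence constant, so that the gcd has degree 0 in the
    outer variable. *)
Lemma coprimep_of_common f g : f != 0 -> only_constant_common f g ->
  coprimep f g.
Proof.
move=> f0 fg; have h0 : gcdp f g != 0 by rewrite gcdp_eq0 (negPf f0).
have [r [h [r0 eh hL]]] := linX_free_part h0.
have hd u : gcdp f g %| u -> divides h u.
  move=> gu; apply: divides_of_dvdp => //; apply: dvdp_trans gu.
  by rewrite eh dvdp_mull.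
have [||c ec] := fg h; [exact/hd/dvdp_gcdl|exact/hd/dvdp_gcdr|].
rewrite coprimep_def eh ec -polyCM size_polyC.
by move: h0; rewrite eh ec -polyCM polyC_eq0 => ->.
Qed.

(** As long as some linX x divides f, it cannot divide g, hence divides b, and
    it is cancelled from both f and b.  Once f has no such factor, a Bezout
    relation c2 = c1 (u f + v g) with c2 in {poly F} shows that f divides
    c2 b, from which c2 can be removed. *)
Lemma euclid_bivariate f g a b : f != 0 -> only_constant_common f g ->
  f * a = g * b -> divides f b.
Proof.
move: {2}(size (swapXY f)) (leqnn (size (swapXY f))) => n.
elim: n f b => [|n IHn] f b len f0 fg eq.
  by rewrite leqn0 size_poly_eq0 swapXY_eq0 (negPf f0) in len.
have [[x [f' ef]]|noL] := pselect (exists x, divides (linX x) f).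
  have f'0 : f' != 0 by apply: contraNneq f0 => f'0; rewrite ef f'0 mulr0.
  rewrite ef size_swapXY_linX // in len.
  have [Lg|[b' eb]] : divides (linX x) g \/ divides (linX x) b.
  - by apply: linX_prime; exists (f' * a); rewrite -eq ef mulrA.
  - by case: (linX_nonconstant (fg _ _ Lg)); exists f'.
  have [||s es] := IHn f' b' len f'0.
  - move=> h [u eu] hg; apply: fg => //.
    by exists (linX x * u); rewrite ef eu mulrCA.
  - by apply: (mulfI (linX_neq0 x)); rewrite mulrA -ef eq eb mulrCA.
  by exists s; rewrite eb es ef mulrA.
have [[u v] /= /Pdiv.Idomain.eqpP[[c1 c2] /= /andP[c10 c20] euv]] :=
  Pdiv.Idomain.Bezout_coprimepP f g (coprimep_of_common f0 fg).
apply: (divides_of_scaled (r := c2) c20 (s := c1%:P * (u * b + v * a))).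
  by move=> x fx; apply: noL; exists x.
have -> : c2%:P = c1%:P * (u * f + v * g) by rewrite mul_polyC euv alg_polyC.
rewrite !mulrDr !mulrDl; congr (_ + _); first by ring.
by transitivity (c1%:P * (v * (g * b))); [|rewrite -eq]; ring.
Qed.

End BivariateEuclid.

(** * Products of pairwise coprime polynomials in C[x,y] *)

Section Transport.
Variable F : closedFieldType.
Local Notation P := (mpoly 2 F).
Local Notation B := {poly {poly F}}.

Definition mpoly_to_biv : P -> B :=
  mmap (polyC \o polyC) (fun i => if i == ord0 then 'X%:P else 'X).
HB.instance Definition _ := GRing.RMorphism.on mpoly_to_biv.

Definition biv_to_mpoly : B -> P :=
  horner_eval (mpolyX F (mnm1 ord_max)) \o
  map_poly (horner_eval (mpolyX F (mnm1 ord0)) \o map_poly (mpolyC 2 (R := F))).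
HB.instance Definition _ := GRing.RMorphism.on biv_to_mpoly.

Lemma biv_to_mpolyC c : biv_to_mpoly c%:P%:P = mpolyC 2 c.
Proof. by rewrite /biv_to_mpoly /= map_polyC /= map_polyC /= /horner_eval !hornerC. Qed.

Lemma mpoly_to_bivC c : mpoly_to_biv (mpolyC 2 c) = c%:P%:P.
Proof. by rewrite /mpoly_to_biv mmapC. Qed.

Lemma mpoly_to_bivM p q : mpoly_to_biv (p * q) = mpoly_to_biv p * mpoly_to_biv q.
Proof. exact: rmorphM. Qed.

Lemma mpoly_to_bivK : cancel mpoly_to_biv biv_to_mpoly.
Proof.
move=> p; elim/mpolyind: p => [|c m p _ _ IH]; first by rewrite !rmorph0.
rewrite !rmorphD /= IH -mul_mpolyC !rmorphM /= mpoly_to_bivC biv_to_mpolyC.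
congr (_ * _ + _); rewrite /mpoly_to_biv mmapX rmorph_prod [RHS]mpolyXE_id.
apply: eq_bigr => i _; rewrite rmorphXn /=; congr (_ ^+ _).
rewrite /biv_to_mpoly /=; case: eqVneq => [->|i0].
  by rewrite map_polyC /= map_polyX /horner_eval hornerC hornerX.
rewrite map_polyX /horner_eval hornerX; congr (mpolyX _ (mnm1 _)).
by apply/val_inj; case: i i0 => [[|[|]]].
Qed.

Lemma biv_to_mpolyK : cancel biv_to_mpoly mpoly_to_biv.
Proof.
have eX : biv_to_mpoly 'X = mpolyX F (mnm1 ord_max).
  by rewrite /biv_to_mpoly /= map_polyX /horner_eval hornerX.
have eY : biv_to_mpoly 'X%:P = mpolyX F (mnm1 ord0).
  by rewrite /biv_to_mpoly /= map_polyC /= map_polyX /horner_eval hornerC hornerX.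
have toX i : mpoly_to_biv (mpolyX F (mnm1 i)) = if i == ord0 then 'X%:P else 'X.
  by rewrite /mpoly_to_biv mmapX mmap1U.
have inner (r : {poly F}) : mpoly_to_biv (biv_to_mpoly r%:P) = r%:P.
  elim/poly_ind: r => [|r c IH]; first by rewrite !rmorph0.
  rewrite polyCD polyCM !rmorphD !rmorphM /= IH eY toX biv_to_mpolyC.
  by rewrite mpoly_to_bivC eqxx.
elim/poly_ind => [|q r IH]; first by rewrite !rmorph0.
by rewrite !rmorphD !rmorphM /= IH eX toX inner.
Qed.

End Transport.

Section CoprimeProducts.
Variable R : realType.
Implicit Types (f g a b : polyxy R).

Lemma euclid_mpoly f g b : f != 0 -> no_common_factor f g ->
  pdvd f (g * b) -> pdvd f b.
Proof.
move=> f0 fg [a eq].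
have [|h [u eu] [w ew]||s es] := @euclid_bivariate _ (mpoly_to_biv f)
   (mpoly_to_biv g) (mpoly_to_biv a) (mpoly_to_biv b).
- by rewrite -(rmorph0 (@mpoly_to_biv R[i])) (can_eq (@mpoly_to_bivK _)).
- have : ~ (1 < mmeasure mdeg (biv_to_mpoly h))%N.
    move=> /fg; apply; split; [exists (biv_to_mpoly u)|exists (biv_to_mpoly w)].
      by rewrite -rmorphM /= -eu mpoly_to_bivK.
    by rewrite -rmorphM /= -ew mpoly_to_bivK.
  move/negP; rewrite -leqNgt => /msize1_polyC eh.
  exists (mcoeff mnm0 (biv_to_mpoly h)).
  by rewrite -[LHS]biv_to_mpolyK {1}eh mpoly_to_bivC.
- by rewrite -mpoly_to_bivM -eq mpoly_to_bivM.
exists (biv_to_mpoly s).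
by rewrite -[b]mpoly_to_bivK es rmorphM /= mpoly_to_bivK.
Qed.

(** Induction on r, dividing E by one factor F i at a time: by Euclid's lemma
    the other factors still divide the quotient.  Thus coprimality of F i with
    a product never has to be established. *)
Lemma prod_coprime_dvd (I : eqType) (r : seq I) (F : I -> polyxy R) E :
  uniq r -> (forall i, i \in r -> F i != 0) ->
  (forall i j, i \in r -> j \in r -> i != j -> no_common_factor (F i) (F j)) ->
  (forall i, i \in r -> pdvd (F i) E) -> pdvd (\prod_(i <- r) F i) E.
Proof.
elim: r E => [|i r IH] E /=; first by rewrite big_nil; exists E; rewrite mul1r.
move=> /andP[ir ur] F0 cop dvd.
have [E' eE] := dvd i (mem_head _ _).
have [||j jr|h eh] := IH E' ur.
- by move=> j jr; apply: F0; rewrite inE jr orbT.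
- by move=> j k jr kr; apply: cop; rewrite inE ?jr ?kr orbT.
- apply: (@euclid_mpoly _ (F i)); first by apply: F0; rewrite inE jr orbT.
    apply: cop; rewrite ?mem_head ?inE ?jr ?orbT //.
    by apply: contraNneq ir => <-.
  by rewrite -eE; apply: dvd; rewrite inE jr orbT.
by exists h; rewrite big_cons eE eh mulrA.
Qed.

End CoprimeProducts.

(** * Invariant curves divide the extactic polynomial *)

(** Multiply M C = f W by the adjugate of M. *)
Lemma divides_det (A : comNzRingType) n (M : 'M[A]_n) (C W : 'cV[A]_n) f :
  M *m C = f *: W -> forall j, divides f (C j 0 * \det M).
Proof.
move=> MC j.
have : \det M *: C = f *: (\adj M *m W).
  by rewrite scalemxAr -MC mulmxA mul_adj_mx mul_scalar_mx.
move: (\adj M *m W) => V /colP/(_ j); rewrite !mxE mulrC => ->.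
by exists (V j 0).
Qed.

Section Extactic.
Variable R : realType.
Implicit Types (f g : polyxy R) (X : vfield R).

Lemma vapply_sum X (I : Type) (r : seq I) (c : I -> R[i]) (F : I -> polyxy R) :
  vapply X (\sum_(j <- r) c j *: F j) = \sum_(j <- r) c j *: vapply X (F j).
Proof.
rewrite /vapply !linear_sum /= !mulr_sumr -big_split /=; apply: eq_bigr => j _.
by rewrite !linearZ /= scalerDr -!scalerAr.
Qed.

Lemma iter_vapply_sum X n (I : Type) (r : seq I) (c : I -> R[i]) (F : I -> polyxy R) :
  iter n (vapply X) (\sum_(j <- r) c j *: F j) =
  \sum_(j <- r) c j *: iter n (vapply X) (F j).
Proof. by elim: n => //= n ->; rewrite vapply_sum. Qed.

Lemma vapplyM X f g : vapply X (f * g) = vapply X f * g + f * vapply X g.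
Proof.
rewrite /vapply !mderivM.
move: (mderiv _ f) (mderiv _ g) (mderiv _ f) (mderiv _ g) => f1 g1 f2 g2.
ring.
Qed.

Lemma pdvd_iter_vapply X f n : invariant_curve X f -> pdvd f (iter n (vapply X) f).
Proof.
move=> [_ [K eK]]; elim: n => [|n [h eh]] /=; first by exists 1; rewrite mulr1.
by exists (K * h + vapply X h); rewrite eh vapplyM eK -mulrA -(mulrDr f (K * h)).
Qed.

(** The coordinates c of f in the basis v satisfy M c = (X^i f)_i, whose
    entries are multiples of f, and one of these coordinates is a nonzero
    constant. *)
Lemma invariant_dvd_extactic l N (v : 'I_N -> polyxy R) X f :
  is_basis_deg_le l v -> invariant_curve X f -> deg_le l f ->
  pdvd f (extactic v X).
Proof.
move=> [_ _ span] inv /span[c ef].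
have f0 : f != 0.
  by case: inv => + _; apply: contraTneq => ->; rewrite msize0.
have [j cj0] : exists j, c j != 0.
  apply/existsP; apply: contraNT f0 => /existsPn c0; rewrite ef big1 // => j _.
  by have /negPn/eqP-> := c0 j; rewrite scale0r.
have /choice[w ew] : forall i : 'I_N, exists w, iter i (vapply X) f = f * w.
  by move=> i; have [w] := pdvd_iter_vapply i inv; exists w.
rewrite /extactic; set M := (\matrix_(i, j) _).
pose C := \col_k mpolyC 2 (c k); pose W := \col_k w k.
have MC : M *m C = f *: W.
  apply/colP => i; rewrite !mxE -ew {1}ef iter_vapply_sum; apply: eq_bigr => k _.
  by rewrite !mxE mulrC mul_mpolyC.
have [q] := divides_det MC j; rewrite mxE => e.
exists ((c j)^-1 *: q).
by rewrite -scalerAr -e mul_mpolyC scalerA mulVf // scale1r.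
Qed.

End Extactic.

(** * Limits *)

(** The common part of convergence of complex numbers and of polynomials: it
    suffices to pass to the limit in determinants, which is needed for both,
    and in matrix products and adjugates. *)
Record ring_limit (A : comNzRingType) (L : (nat -> A) -> A -> Prop) : Prop := {
  limit_cst : forall a, L (fun=> a) a;
  limit_add : forall u w a b, L u a -> L w b -> L (fun k => u k + w k) (a + b);
  limit_mul : forall u w a b, L u a -> L w b -> L (fun k => u k * w k) (a * b)
}.

Section RingLimit.
Variables (A : comNzRingType) (L : (nat -> A) -> A -> Prop).
Hypothesis limL : ring_limit L.

Lemma limit_sum (I : Type) (r : seq I) (P : pred I) (u : nat -> I -> A) a :
  (forall i, P i -> L (u^~ i) (a i)) ->
  L (fun k => \sum_(i <- r | P i) u k i) (\sum_(i <- r | P i) a i).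
Proof.
move=> ua; elim: r => [|i r IH].
  by under eq_fun do rewrite big_nil; rewrite big_nil; apply: limit_cst.
under eq_fun do rewrite big_cons; rewrite big_cons; case: ifP => // Pi.
by apply: limit_add => //; apply: ua.
Qed.

Lemma limit_prod (I : Type) (r : seq I) (u : nat -> I -> A) a :
  (forall i, L (u^~ i) (a i)) ->
  L (fun k => \prod_(i <- r) u k i) (\prod_(i <- r) a i).
Proof.
move=> ua; elim: r => [|i r IH].
  by under eq_fun do rewrite big_nil; rewrite big_nil; apply: limit_cst.
by under eq_fun do rewrite big_cons; rewrite big_cons; apply: limit_mul.
Qed.

Definition limit_mx m n (M : nat -> 'M[A]_(m, n)) (M0 : 'M[A]_(m, n)) :=
  forall i j, L (fun k => M k i j) (M0 i j).

Lemma limit_mx_cst m n (M : 'M[A]_(m, n)) : limit_mx (fun=> M) M.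
Proof. by move=> i j; apply: limit_cst. Qed.

Lemma limit_mulmx m n p (M : nat -> 'M[A]_(m, n)) M0 (N : nat -> 'M[A]_(n, p)) N0 :
  limit_mx M M0 -> limit_mx N N0 -> limit_mx (fun k => M k *m N k) (M0 *m N0).
Proof.
move=> hM hN i j; under eq_fun do rewrite mxE; rewrite mxE.
by apply: limit_sum => l _; apply: limit_mul.
Qed.

Lemma limit_det n (M : nat -> 'M[A]_n) M0 :
  limit_mx M M0 -> L (fun k => \det (M k)) (\det M0).
Proof.
move=> hM; apply: limit_sum => s _.
by apply: (limit_mul limL); [apply: (limit_cst limL)|apply: limit_prod].
Qed.

Lemma limit_adj n (M : nat -> 'M[A]_n) M0 :
  limit_mx M M0 -> limit_mx (fun k => \adj (M k)) (\adj M0).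
Proof.
move=> hM i j; under eq_fun do rewrite mxE; rewrite mxE /cofactor.
apply: (limit_mul limL); first exact: (limit_cst limL).
apply: limit_det => a b; under eq_fun do rewrite !mxE.
by rewrite !mxE.
Qed.

End RingLimit.

Section Convergence.
Variable R : realType.
Implicit Types (p q : polyxy R) (u w : nat -> polyxy R).

Definition cvgC (u : nat -> R[i]) (a : R[i]) : Prop :=
  (u : nat -> R[i]^o) @ \oo --> (a : R[i]^o).

Lemma cvgC_ring_limit : ring_limit cvgC.
Proof.
split=> [a|u w a b|u w a b]; first exact: cvg_cst.
- exact: cvgD.
- exact: cvgM.
Qed.

Lemma cvgC_unique (s : nat -> R[i]) a b : cvgC s a -> cvgC s b -> a = b.
Proof. exact: (@cvg_unique _ (@norm_hausdorff _ R[i]^o)). Qed.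

(** Without the degree bound, coefficientwise convergence does not preserve
    divisibility: 1 - x divides 1 - x^k, which converges to 1. *)
Definition bounded_cvg u p : Prop :=
  (exists D, forall k, (mmeasure mdeg (u k) <= D)%N) /\ cvg_poly u p.

Lemma msize_le_mcoeff D p :
  (forall m, (D <= mdeg m)%N -> mcoeff m p = 0) -> (mmeasure mdeg p <= D)%N.
Proof.
move=> p0; rewrite msizeE; apply/bigmax_leqP_seq => m + _; apply: contraTT.
by rewrite -leqNgt mcoeff_msupp negbK => /p0/eqP.
Qed.

Lemma mcoeff_ge_msize p m : (mmeasure mdeg p <= mdeg m)%N -> mcoeff m p = 0.
Proof. by move=> /msize_mdeg_ge/memN_msupp_eq0. Qed.

Lemma msize_cvg u p D : (forall k, (mmeasure mdeg (u k) <= D)%N) -> cvg_poly u p ->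
  (mmeasure mdeg p <= D)%N.
Proof.
move=> uD up; apply: msize_le_mcoeff => m Dm.
apply: (cvgC_unique (up m)); have -> : (fun k => mcoeff m (u k)) = fun=> 0.
  by apply/funext => k; apply: mcoeff_ge_msize; apply: leq_trans Dm.
exact: (limit_cst cvgC_ring_limit).
Qed.

Lemma bounded_cvg_ring_limit : ring_limit bounded_cvg.
Proof.
split=> [p|u w p q [[D uD] up] [[E wE] wq]|u w p q [[D uD] up] [[E wE] wq]].
- split; first by exists (mmeasure mdeg p).
  by move=> m; apply: (limit_cst cvgC_ring_limit).
- split.
    exists (maxn D E) => k; apply: leq_trans (msizeD_le _ _) _.
    by rewrite geq_max !leq_max uD wE orbT.
  move=> m; rewrite mcoeffD; under eq_fun do rewrite mcoeffD.
  exact: (limit_add cvgC_ring_limit (up _) (wq _)).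
- split.
    exists (D + E).+1 => k; apply: leq_trans (msizeM_le _ _) _.
    by rewrite ltnS leq_add.
  move=> m; rewrite mcoeffM; under eq_fun do rewrite mcoeffM.
  apply: (limit_sum cvgC_ring_limit) => i _.
  exact: (limit_mul cvgC_ring_limit (up _) (wq _)).
Qed.

Lemma bounded_cvg_mderiv i u p :
  bounded_cvg u p -> bounded_cvg (fun k => mderiv i (u k)) (mderiv i p).
Proof.
move=> [[D uD] up]; split.
  exists D => k; apply: msize_le_mcoeff => m Dm; rewrite mcoeff_mderiv.
  rewrite mcoeff_ge_msize ?mul0rn // (leq_trans (uD k)) //.
  by rewrite mdegD (leq_trans Dm) ?leq_addr.
move=> m; rewrite mcoeff_mderiv -mulr_natr.
under eq_fun do rewrite mcoeff_mderiv -mulr_natr.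
apply: (limit_mul cvgC_ring_limit); [exact: up|].
exact: (limit_cst cvgC_ring_limit).
Qed.

Lemma bounded_cvg_iter_vapply (Xs : nat -> vfield R) X v n :
  bounded_cvg (fun k => (Xs k).1) X.1 -> bounded_cvg (fun k => (Xs k).2) X.2 ->
  bounded_cvg (fun k => iter n (vapply (Xs k)) v) (iter n (vapply X) v).
Proof.
move=> X1 X2; have lim := bounded_cvg_ring_limit.
elim: n => [|n IH]; first exact: (limit_cst lim).
exact: (limit_add lim (limit_mul lim X1 (bounded_cvg_mderiv ord0 IH))
                      (limit_mul lim X2 (bounded_cvg_mderiv ord_max IH))).
Qed.

Lemma bounded_cvg_extactic N (v : 'I_N -> polyxy R) (Xs : nat -> vfield R) X :
  bounded_cvg (fun k => (Xs k).1) X.1 -> bounded_cvg (fun k => (Xs k).2) X.2 ->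
  bounded_cvg (fun k => extactic v (Xs k)) (extactic v X).
Proof.
move=> X1 X2; apply: (limit_det bounded_cvg_ring_limit) => i j.
under eq_fun do rewrite mxE; rewrite mxE.
exact: bounded_cvg_iter_vapply.
Qed.

(** * Divisibility passes to the limit *)

Definition exponent D (i : 'I_#|{: bmultinom 2 D}|) : multinom 2 :=
  bmnm (enum_val i).

Section MultiplicationMatrix.
Variable D : nat.

Definition coeffs p : 'rV[R[i]]_#|{: bmultinom 2 D}| :=
  \row_i mcoeff (exponent i) p.

Definition mpoly_of_coeffs (c : 'rV[R[i]]_#|{: bmultinom 2 D}|) : polyxy R :=
  \sum_i c 0 i *: mpolyX R[i] (exponent i).

Lemma coeffsK p : (mmeasure mdeg p <= D)%N -> mpoly_of_coeffs (coeffs p) = p.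
Proof.
move=> pD; rewrite [RHS](mpolywE pD) /mpoly_of_coeffs.
rewrite (reindex (@enum_val _ {: bmultinom 2 D})) /=; last first.
  by apply: onW_bij; apply: enum_val_bij.
by apply: eq_bigr => i _; rewrite mxE.
Qed.

Lemma mpoly_of_coeffsK : cancel mpoly_of_coeffs coeffs.
Proof.
move=> c; apply/rowP => i; rewrite mxE /mpoly_of_coeffs raddf_sum (bigD1 i) //=.
rewrite mcoeffZ mcoeffX eqxx mulr1 big1 ?addr0 // => j ji.
rewrite mcoeffZ mcoeffX; case: eqP => [|_]; last by rewrite mulr0.
by move=> /val_inj/enum_val_inj e; rewrite e eqxx in ji.
Qed.

Lemma msize_mpoly_of_coeffs c : (mmeasure mdeg (mpoly_of_coeffs c) <= D)%N.
Proof.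
apply: leq_trans (msize_sum _ _ _) _; apply/bigmax_leqP => i _.
by apply: leq_trans (msizeZ_le _ _) _; rewrite msizeX /exponent bmdeg.
Qed.

End MultiplicationMatrix.

(** The matrix of multiplication by p, from degrees less than D to degrees less
    than E, acting on row vectors of coefficients.  Terms of degree at
    least E in the product are dropped. *)
Definition mulmatrix D E p : 'M[R[i]]_(#|{: bmultinom 2 D}|, #|{: bmultinom 2 E}|) :=
  \matrix_(i, j) mcoeff (exponent j) (mpolyX R[i] (exponent i) * p).

Lemma mul_mulmatrix D E p c :
  c *m mulmatrix D E p = coeffs E (mpoly_of_coeffs c * p).
Proof.
apply/rowP => j; rewrite !mxE /mpoly_of_coeffs mulr_suml raddf_sum.
by apply: eq_bigr => i _; rewrite mxE -mcoeffZ scalerAl.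
Qed.

Lemma limit_mulmatrix D E u p : bounded_cvg u p ->
  limit_mx cvgC (fun k => mulmatrix D E (u k)) (mulmatrix D E p).
Proof.
move=> up i j; under eq_fun do rewrite mxE; rewrite mxE.
have lim := bounded_cvg_ring_limit.
by have [_] := limit_mul lim (limit_cst lim (mpolyX R[i] (exponent i))) up; apply.
Qed.

(** The quotients are eliminated with a one-sided inverse B of the
    multiplication matrix A0 of the limit p.  Hence their coefficients need not
    be shown to converge, nor even to stay bounded. *)
Lemma pdvd_limit u w p q :
  bounded_cvg u p -> bounded_cvg w q -> p != 0 -> (forall k, u k != 0) ->
  (forall k, pdvd (u k) (w k)) -> pdvd p q.
Proof.
move=> up wq p0 u0 uw; have [[Du uD] pc] := up; have [[Dw wD] qc] := wq.
(* Quotients have degree less than D, and products by them degree less than E. *)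
pose D := Dw; pose E := (D + Du).+1.
pose A k := mulmatrix D E (u k); pose A0 := mulmatrix D E p.
have qD : (mmeasure mdeg q <= D)%N := msize_cvg wD qc.
have pD : (mmeasure mdeg p <= Du)%N := msize_cvg uD pc.
have free : row_free A0.
  apply: inj_row_free => c; rewrite mul_mulmatrix => cp0.
  have : mpoly_of_coeffs c * p = 0.
    rewrite -[LHS](@coeffsK E) ?cp0.
      by rewrite /mpoly_of_coeffs big1 // => i _; rewrite mxE scale0r.
    apply: leq_trans (msizeM_le _ _) _.
    by rewrite ltnS leq_add // msize_mpoly_of_coeffs.
  move/eqP; rewrite mulf_eq0 (negPf p0) orbF => /eqP c0.
  by rewrite -[c]mpoly_of_coeffsK c0; apply/rowP => i; rewrite !mxE mcoeff0.
have [B AB] := row_freeP free.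
(* det (A k *m B) may vanish for small k, so it is not divided by. *)
have key k : \det (A k *m B) *: coeffs E (w k) =
    coeffs E (w k) *m (B *m \adj (A k *m B) *m A k).
  have [h eh] := uw k.
  have hD : (mmeasure mdeg h <= D)%N.
    have [->|h0] := eqVneq h 0; first by rewrite msize0.
    apply: leq_trans (wD k); rewrite eh msizeM //.
    have : mmeasure mdeg (u k) != 0%N by rewrite mmeasure_poly_eq0.
    by case: (mmeasure _ _) => // n _; rewrite addSn leq_addl.
  have -> : coeffs E (w k) = coeffs D h *m A k.
    by rewrite mul_mulmatrix coeffsK // eh mulrC.
  rewrite mulmxA (mulmxA _ B) -(mulmxA _ (A k) B) -(mulmxA (coeffs D h)).
  rewrite mulmxA -(mulmxA (coeffs D h)) mul_mx_adj.
  by rewrite mul_mx_scalar scalemxAl.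
have limC := cvgC_ring_limit.
have Alim : limit_mx cvgC A A0 := limit_mulmatrix up.
have Blim := limit_mx_cst limC B.
have wlim : limit_mx cvgC (fun k => coeffs E (w k)) (coeffs E q).
  by move=> i j; under eq_fun do rewrite mxE; rewrite mxE; apply: qc.
have ABlim := limit_mulmx limC Alim Blim.
have eq : coeffs E q = coeffs E q *m B *m A0.
  apply/matrixP => i j.
  have l1 : cvgC (fun k => (\det (A k *m B) *: coeffs E (w k)) i j) (coeffs E q i j).
    have -> : coeffs E q i j = \det (A0 *m B) * coeffs E q i j.
      by rewrite AB det1 mul1r.
    under eq_fun do rewrite mxE.
    exact: (limit_mul limC (limit_det limC ABlim) (wlim i j)).
  have l2 := limit_mulmx limC wlim (limit_mulmx limC
    (limit_mulmx limC Blim (limit_adj limC ABlim)) Alim) i j.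
  rewrite AB adj1 mulmx1 mulmxA in l2.
  by apply: cvgC_unique l1 _; under eq_fun do rewrite key.
rewrite mul_mulmatrix in eq.
exists (mpoly_of_coeffs (coeffs E q *m B)).
rewrite -[LHS](@coeffsK E); last by rewrite (leq_trans qD) // leqW // leq_addr.
rewrite {1}eq mulrC coeffsK //; apply: leq_trans (msizeM_le _ _) _.
by rewrite ltnS addnC leq_add // msize_mpoly_of_coeffs.
Qed.

End Convergence.

(** * Comparison of the multiplicities *)

(** The value m = 0 may belong to the geometric set S, while the algebraic set T
    contains positive exponents only; T 1 makes up for it. *)
Lemma le_sup_nat (R : realType) (S T : set nat) :
  T 1 -> (forall m, (0 < m)%N -> S m -> T m) ->
  (ereal_sup [set (m%:R : R)%:E | m in S] <= ereal_sup [set (m%:R : R)%:E | m in T])%E.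
Proof.
move=> T1 ST; apply: ge_ereal_sup => _ [m Sm <-].
case: m Sm => [_|m Sm]; last by apply: ereal_sup_ubound; exists m.+1 => //; apply: ST.
apply: (@le_trans _ _ 1%E); first by rewrite lee_fin.
by apply: ereal_sup_ubound; exists 1.
Qed.

(** The product of the m curves of X_k divides the extactic polynomial of X_k,
    and it converges to f^m. *)
Lemma geom_realizable_dvd (R : realType) d l N (v : 'I_N -> polyxy R) X f m :
  is_basis_deg_le l v -> f != 0 -> geom_realizable d l X f m ->
  pdvd (f ^+ m) (extactic v X).
Proof.
move=> hv f0 [Xs [fs [degX [cX1 cX2] inv cop cf]]].
have bX1 : bounded_cvg (fun k => (Xs k).1) X.1.
  by split; [exists d.+1 => k; have <- := degX k; exact: leq_maxl|exact: cX1].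
have bX2 : bounded_cvg (fun k => (Xs k).2) X.2.
  by split; [exists d.+1 => k; have <- := degX k; exact: leq_maxr|exact: cX2].
have lim := bounded_cvg_ring_limit R.
have fs0 k i : fs k i != 0.
  by have [[+ _] _] := inv k i; apply: contraTneq => ->; rewrite msize0.
have bprod : bounded_cvg (fun k => \prod_(i < m) fs k i) (f ^+ m).
  rewrite -[m in f ^+ m]card_ord -prodr_const.
  have bf i : bounded_cvg (fs^~ i) f.
    by split; [exists l.+1 => k; have [_] := inv k i; exact|exact: cf].
  exact: (limit_prod lim _ bf).
apply: (pdvd_limit bprod (bounded_cvg_extactic v bX1 bX2)).
- by rewrite expf_neq0.
- by move=> k; apply/prodf_neq0 => i _.
move=> k; apply: prod_coprime_dvd; first exact: index_enum_uniq.
- by move=> i _.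
- by move=> i j _ _; apply: cop.
- by move=> i _; have [fi fl] := inv k i; apply: invariant_dvd_extactic fi fl.
Qed.

Theorem proposition6 (R : realType) (d l : nat) (X : vfield R) (f : polyxy R)
    (v : 'I_(dim_deg_le l) -> polyxy R)
    (hX : vfield_degree d X) (hf : invariant_curve X f) (hl : (0 < l)%N)
    (hv : is_basis_deg_le l v) :
  (geom_mult d l X f <= alg_mult v X f)%E.
Proof.
rewrite /geom_mult /alg_mult; case: ltnP => // fl.
case: ifP => _; first exact: leey.
have f0 : f != 0.
  by case: hf => + _; apply: contraTneq => ->; rewrite msize0.
apply: le_sup_nat => [|m m0 real]; split=> //.
  by rewrite expr1; apply: invariant_dvd_extactic hf fl.
exact: geom_realizable_dvd real.
Qed.
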